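(* For each $n\ge1$ and each $d\geq n$, $\mathfrak{p}_n(d)\leq\mathcal{G}^{\omega^2\cdot 8n}(d)$.
   Context: Definition of $\mathfrak{p}_n$: - $\mathfrak{d}_n(b)=(2b)^{2^n}$; - $\mathfrak{e}(n,b)=2^{(b+\mathfrak{d}_{n-1}(b))^{n-1}+1}\,b+b+\mathfrak{d}_{n-1}(b)$; - $\zeta_0(n,d)=\binom{n+\mathfrak{d}_n(d)}{n}$; - $\zeta_1(n,d,b)=\left(\binom{b+n}{n}+2\right)\zeta_0(n,d)$; - $\zeta_2(n,d,b)=(\zeta_1(n,d,b)+1)^{2^{\zeta_1(n,d,b)}-1}$; - $\mathfrak{p}_1(d)=d$, and for $n\ge 2$, with $\upsilon(n,d)=\zeta_1(n-1,\mathfrak{p}_{n-1}(d),d)\,\zeta_2(n-1,\mathfrak{p}_{n-1}(d),d)$, $\mathfrak{p}_n(d)=\max\left\{2\binom{\upsilon(n,d)+n}{n}\upsilon(n,d),\ \mathfrak{e}(n-1,d)\right\}$. Ordinal iteration: for an ordinal $0<\alpha<\epsilon_0$ with Cantor normal form $\alpha=\sum_{\beta\in I}\omega^\beta c_\beta$ ($I$ a finite set of ordinals, $c_\beta$ positive integers), write $\min\alpha=\min I$ (the least exponent). For $x\in\mathbb{N}$ define $\alpha[x]<\alpha$ recursively: $\alpha[x]=\alpha-1$ (the predecessor of $\alpha$) if $\min\alpha=0$, and otherwise $$\alpha[x]=\sum_{\beta\in I\setminus\{\min\alpha\}}\omega^\beta c_\beta+\omega^{\min\alpha}(c_{\min\alpha}-1)+\omega^{(\min\alpha)[x]}x.$$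 For $g:\mathbb{N}\to\mathbb{N}$, define $g^0(b)=b$ and $g^\alpha(b)=g^{\alpha[b]}(g(b))$ for $\alpha>0$. Finally $\mathcal{G}(b)=b+1$. *)

(* Defs.v *)
From mathcomp Require Import all_boot.
Set Implicit Arguments.
Unset Strict Implicit.
Unset Printing Implicit Defensive.

(** * The bound [p_n] *)

Definition dd (n b : nat) : nat := (2 * b) ^ (2 ^ n).

Definition ee (n b : nat) : nat :=
  2 ^ ((b + dd n.-1 b) ^ n.-1 + 1) * b + b + dd n.-1 b.

Definition zeta0 (n d : nat) : nat := 'C(n + dd n d, n).

Definition zeta1 (n d b : nat) : nat := ('C(b + n, n) + 2) * zeta0 n d.

Definition zeta2 (n d b : nat) : nat :=
  (zeta1 n d b + 1) ^ (2 ^ zeta1 n d b - 1).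

(** [pp n] is meaningful for [1 <= n] only; the value at [n = 0] is junk. *)
Fixpoint pp (n d : nat) : nat :=
  match n with
  | 0 | 1 => d
  | m.+1 =>
      let u := zeta1 m (pp m d) d * zeta2 m (pp m d) d in
      maxn (2 * 'C(u + n, n) * u) (ee m d)
  end.

Definition upsilon (n d : nat) : nat :=
  zeta1 n.-1 (pp n.-1 d) d * zeta2 n.-1 (pp n.-1 d) d.

Lemma pp1 d : pp 1 d = d.
Proof. by []. Qed.

Lemma pp_rec n d : 2 <= n ->
  pp n d = maxn (2 * 'C(upsilon n d + n, n) * upsilon n d) (ee n.-1 d).
Proof. by case: n => [|[|n]]. Qed.

(** * Ordinals below epsilon_0 *)

(** [ocons e c r] denotes [omega^e * (c + 1) + r].  An ordinal below epsilon_0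
    is a term satisfying [onf]: exponents strictly decrease from left to right,
    hereditarily. *)
Inductive ord : Type :=
| ozero
| ocons of ord & nat & ord.

Inductive olt : ord -> ord -> Prop :=
| olt_zero e c r : olt ozero (ocons e c r)
| olt_exp e c r e' c' r' : olt e e' -> olt (ocons e c r) (ocons e' c' r')
| olt_coef e c r c' r' : c < c' -> olt (ocons e c r) (ocons e c' r')
| olt_tail e c r r' : olt r r' -> olt (ocons e c r) (ocons e c r').

Definition olead_lt (r e : ord) : Prop :=
  if r is ocons e' _ _ then olt e' e else True.

Fixpoint onf (a : ord) : Prop :=
  if a is ocons e _ r then [/\ onf e, onf r & olead_lt r e] else True.

(** [omega^e * k + r], where [k] may be [0]. *)
Definition oterm (e : ord) (k : nat) (r : ord) : ord :=
  if k is c.+1 then ocons e c r else r.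

Definition omul_pow (e : ord) (k : nat) : ord := oterm e k ozero.

Lemma onf_mul_pow e k : onf e -> onf (omul_pow e k).
Proof. by case: k. Qed.

Definition ofin (k : nat) : ord := omul_pow ozero k.

(** [fund a x] is [a[x]].  The recursion descends to the last term
    [omega^e * (c + 1)] of the normal form, so that [e] is the least exponent.
    The value at [ozero] is junk. *)
Fixpoint fund (a : ord) (x : nat) : ord :=
  match a with
  | ozero => ozero
  | ocons e c ozero =>
      match e with
      | ozero => omul_pow ozero c
      | _ => oterm e c (omul_pow (fund e x) x)
      end
  | ocons e c r => ocons e c (fund r x)
  end.

Lemma fund_tail e c r x : r <> ozero ->
  fund (ocons e c r) x = ocons e c (fund r x).
Proof. by case: r. Qed.

Lemma fund_succ c x : fund (ocons ozero c ozero) x = omul_pow ozero c.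
Proof. by []. Qed.

Lemma fund_lim e c x : e <> ozero ->
  fund (ocons e c ozero) x = oterm e c (omul_pow (fund e x) x).
Proof. by case: e. Qed.

Lemma ozero_dec (a : ord) : {a = ozero} + {a <> ozero}.
Proof. by case: a => [|e c r]; [left | right]. Defined.

Lemma olt_trans a b c : olt a b -> olt b c -> olt a c.
Proof.
move=> ab; elim: ab c => {a b} [e k r|e k r e' k' r' lee IH|e k r k' r' lk
  |e k r r' _ IH] d H; inversion H; subst;
  by eauto using olt, ltn_trans.
Qed.

Lemma fund_lt a x : a <> ozero -> olt (fund a x) a.
Proof.
elim: a => // e IHe c r IHr _.
case: (ozero_dec r) => [->|nr]; last first.
  by rewrite fund_tail //; apply: olt_tail; exact: IHr.
case: (ozero_dec e) => [->|ne].
  by rewrite fund_succ; case: c => [|c]; constructor.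
rewrite fund_lim //; case: c => [|c]; last by apply: olt_coef.
by case: x IHe {IHr} => [|x] IHe; constructor; exact: IHe.
Qed.

Lemma fund_nf a x : onf a -> onf (fund a x).
Proof.
elim: a => // e IHe c r IHr [ne nr lr].
case: (ozero_dec r) => [->|r0]; last first.
  rewrite fund_tail //; split; [done | exact: IHr |].
  have := fund_lt x r0; case: (fund r x) => //= e1 c1 r1.
  case: r lr {nr IHr r0} => [|e2 c2 r2] /= lr H; inversion H; subst=> //.
  exact: olt_trans lr.
case: (ozero_dec e) => [->|e0].
  by rewrite fund_succ; case: c.
rewrite fund_lim //; case: c => [|c]; case: x IHe {IHr} => [|x] IHe //=.
  by split=> //; exact: IHe.
split=> //; first by split=> //; exact: IHe.
exact: fund_lt.
Qed.

Definition ostep (b a : ord) : Prop := a <> ozero /\ exists x, b = fund a x.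

Lemma ostep_fund a x : a <> ozero -> ostep (fund a x) a.
Proof. by move=> a0; split=> //; exists x. Qed.

Lemma ostep_wf : well_founded ostep.
Proof.
(* No [//] on [Acc] goals: [done] would apply [Acc_intro] forever. *)
have acc0 : Acc ostep ozero by constructor=> b [].
have cons_acc e c r : Acc ostep (ocons e c ozero) -> Acc ostep r ->
    Acc ostep (ocons e c r).
  move=> He; elim=> {}r _ IH.
  case: (ozero_dec r) => [->|r0]; first exact: He.
  constructor=> b [_ [x ->]]; rewrite (fund_tail _ _ _ r0).
  apply: IH; exact: ostep_fund.
have pow_acc e : Acc ostep e -> forall c, Acc ostep (ocons e c ozero).
  elim=> {}e _ IH; elim=> [|c IHc]; constructor=> b [_ [x ->]].
    case: (ozero_dec e) => [->|e0]; first exact: acc0.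
    rewrite (fund_lim _ _ e0) /=.
    case: x => [|x] /=; first exact: acc0.
    apply: IH; exact: ostep_fund.
  case: (ozero_dec e) => [e0|e0].
    move: IHc; rewrite e0; apply.
  rewrite (fund_lim _ _ e0) /=; apply: cons_acc; first exact: IHc.
  case: x => [|x] /=; first exact: acc0.
  apply: IH; exact: ostep_fund.
elim=> [|e He c r Hr]; first exact: acc0.
apply: cons_acc; [exact: pow_acc | exact: Hr].
Qed.

Fixpoint oiter_acc (g : nat -> nat) (a : ord) (H : Acc ostep a) (b : nat)
    {struct H} : nat :=
  match ozero_dec a with
  | left _ => b
  | right a0 => oiter_acc g (Acc_inv H (ostep_fund b a0)) (g b)
  end.

(** [oiter g a b] is [g^a(b)]; see [oiter0] and [oiterS]. *)
Definition oiter (g : nat -> nat) (a : ord) (b : nat) : nat :=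
  oiter_acc g (ostep_wf a) b.

Lemma oiter_acc_irr g a (H K : Acc ostep a) b :
  oiter_acc g H b = oiter_acc g K b.
Proof.
move: a H K b; fix IH 2 => a [h] [k] b /=.
case: (ozero_dec a) => // a0; exact: IH.
Qed.

Lemma oiter0 g b : oiter g ozero b = b.
Proof. by rewrite /oiter; case: (ostep_wf ozero). Qed.

Lemma oiterS g a b : a <> ozero -> oiter g a b = oiter g (fund a b) (g b).
Proof.
rewrite /oiter; case: (ostep_wf a) => h a0 /=.
by case: (ozero_dec a) => // a0'; exact: oiter_acc_irr.
Qed.

Definition GG (b : nat) : nat := b + 1.

(* Main.v *)
Require Import Defs.
From mathcomp Require Import all_boot zify.

(** Each term [omega^2] iterates the successor into a single function of
    exponential growth, and eight exponentials per step of the recursion leave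
    room to spare.

    Along multiples of [omega^2] the hierarchy can be evaluated exactly.  Iterating along
    [omega^e * k] is [k]-fold iteration along [omega^e] ([oiter_mul_pow]), so
    that [b |-> b + 1] becomes [b |-> 2 b + 1] along [omega], and
    [b |-> 2^b (b + 2) - 1] along [omega^2].  Call this last function [F]
    ([expgrow] below); the claim is then [p_n(d) <= F^(8 n) (d)].

    The proof is by induction on [n].  Suppose that [p_(n-1)(d) <= X], where
    [X] is an iterate of [F] at [d]; as [F] is extensive, [n <= d <= X].
    Binomials are estimated by [C(a, b) <= 2^a], and a product or a power by
    [x * 2^x <= F x].  This gives
    - [d_m(X) + 3 X + 1 <= F^2 X] for [m < X], hence [zeta_1 <= F^3 X];
    - [zeta_1 zeta_2 <= 2^(zeta_1 2^zeta_1)], hence [upsilon <= F^5 X];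
    - [2 C(upsilon + n, n) upsilon <= 2^(3 U + 1) <= F (F U)] for
      [U = F^5 X], which is at least [upsilon] and [n];
    - [e(n-1, d) <= F^6 X], by the same bound on [d_m].
    So one step costs seven applications of [F], and eight are available. *)

(** * Iteration along ordinals *)

(** The fundamental sequence only ever acts on the last term, so the tail is
    used up before the head [omega^e * (c + 1)] is touched. *)
Lemma oiter_cons g e c r b :
  oiter g (ocons e c r) b = oiter g (ocons e c ozero) (oiter g r b).
Proof.
elim: (ostep_wf r) b => {}r _ IH b.
case: (ozero_dec r) => [->|r0]; first by rewrite oiter0.
rewrite oiterS // fund_tail // IH; last exact: ostep_fund.
by rewrite -oiterS.
Qed.

Lemma oiter_term g e k r b :
  oiter g (oterm e k r) b = oiter g (omul_pow e k) (oiter g r b).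
Proof. by case: k => [|c] /=; rewrite ?oiter0 // oiter_cons. Qed.

Lemma fund_pow e c x :
  fund (ocons e c ozero) x = oterm e c (fund (omul_pow e 1) x).
Proof. by case: e. Qed.

Lemma oiter_mul_pow g e k b :
  oiter g (omul_pow e k) b = iter k (oiter g (omul_pow e 1)) b.
Proof.
elim: k b => [|k IH] b; first by rewrite oiter0.
by rewrite iterSr -IH /= oiterS // fund_pow oiter_term -oiterS.
Qed.

Lemma oiter_omega g b : oiter g (omul_pow (ofin 1) 1) b = iter b.+1 g b.
Proof.
rewrite iterSr oiterS //= -/(omul_pow ozero b) oiter_mul_pow.
by apply: eq_iter => c; rewrite /= oiterS //= oiter0.
Qed.

Definition expgrow (b : nat) : nat := 2 ^ b * (b + 2) - 1.

Lemma oiter_GG_omega2 b :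
  oiter GG (omul_pow (ofin 2) 1) b = expgrow b.
Proof.
have omegaE c : oiter GG (omul_pow (ofin 1) 1) c = 2 * c + 1.
  rewrite oiter_omega.
  have iterGG k : iter k GG c = c + k by elim: k => //= [|k ->]; rewrite /GG; lia.
  by rewrite iterGG; lia.
rewrite oiterS //= -/(omul_pow (ofin 1) b) oiter_mul_pow.
(* [c |-> 2 c + 1] doubles [c + 1]. *)
have iterE k c : iter k (oiter GG (omul_pow (ofin 1) 1)) c + 1 = 2 ^ k * (c + 1).
  elim: k => [|k IH]; first by rewrite mul1n.
  by rewrite iterS omegaE expnS -mulnA -IH; lia.
have := iterE b (GG b); rewrite /expgrow /GG -addnA => <-.
by rewrite addnK.
Qed.

(** * Growth of the iterates *)

Lemma expgrow_mono : {homo expgrow : x y / x <= y}.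
Proof.
move=> x y xy; rewrite /expgrow leq_sub2r // leq_mul ?leq_add2r //.
by rewrite leq_exp2l.
Qed.

Lemma mul_exp_le_expgrow x : x * 2 ^ x + x < expgrow x.
Proof. by rewrite /expgrow; have := ltn_expl x (ltnSn 1); nia. Qed.

Lemma exp_le_expgrow x : 2 ^ x <= expgrow x.
Proof. by rewrite /expgrow; have := ltn_expl x (ltnSn 1); nia. Qed.

Lemma linear_le_expgrow x : 3 * x + 1 <= expgrow x.
Proof. by rewrite /expgrow; have := ltn_expl x (ltnSn 1); nia. Qed.

Lemma leq_expgrow x : x <= expgrow x.
Proof. by have := mul_exp_le_expgrow x; lia. Qed.

Lemma leq_iter_expgrow k x : x <= iter k expgrow x.
Proof. by elim: k => //= k /leq_trans; apply; exact: leq_expgrow. Qed.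

Lemma exp_le_expgrow_leq x y : x <= y -> 2 ^ x <= expgrow y.
Proof. by move=> /expgrow_mono; apply: leq_trans; exact: exp_le_expgrow. Qed.

Lemma bin_le_exp2 n m : 'C(n, m) <= 2 ^ n.
Proof.
elim: n m => [|n IH] [|m]; rewrite ?bin0 ?expn_gt0 //.
by rewrite binS expnS mul2n -addnn leq_add.
Qed.

(** * One step of the recursion *)

Local Notation F := expgrow.

(** Since [2 a <= 2^X], [d_k(a)] is at most [2^(X 2^k)], whose exponent is below
    [F X]; two applications of [F] thus suffice.  In [zeta1] the value [d_k(a)]
    becomes an exponent of [2]; the summand [3 X + 1] pays there for the factor
    [C(b + n, n) + 2]. *)
Lemma dd_bound k a X : k < X -> a <= X -> dd k a + 3 * X + 1 <= F (F X).
Proof.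
move=> k_lt_X a_le_X.
have dd_le : dd k a <= 2 ^ (X * 2 ^ k).
  rewrite expnM /dd leq_exp2r ?expn_gt0 //.
  case: X k_lt_X a_le_X => // x _ ax; rewrite expnS leq_mul2l /=.
  exact: leq_trans ax (ltn_expl x _).
have exp_lt : X * 2 ^ k < F X.
  apply: leq_trans (mul_exp_le_expgrow X); rewrite ltnS.
  by apply: leq_trans (leq_addr _ _); rewrite leq_mul2l leq_exp2l // (ltnW k_lt_X) orbT.
have FX := linear_le_expgrow X.
have FFX := mul_exp_le_expgrow (F X).
have : 2 ^ (X * 2 ^ k) <= F X * 2 ^ F X.
  apply: (@leq_trans (2 ^ F X)); first by rewrite leq_exp2l // ltnW.
  by rewrite leq_pmull //; lia.
by lia.
Qed.

Lemma zeta1_bound m d p X :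
  m < d -> d <= X -> p <= X -> zeta1 m p d <= F (F (F X)).
Proof.
move=> m_lt_d d_le_X p_le_X.
have := dd_bound m p X; rewrite /zeta1 /zeta0 => /(_ (leq_trans m_lt_d d_le_X) p_le_X) ddX.
apply: leq_trans (exp_le_expgrow_leq _ _ ddX).
apply: (@leq_trans (2 ^ (d + m).+1 * 2 ^ (m + dd m p))).
  apply: leq_mul; last exact: bin_le_exp2.
  rewrite expnS mul2n -addnn; apply: leq_add; first exact: bin_le_exp2.
  by rewrite -[2]/(2 ^ 1) leq_exp2l //; lia.
by rewrite -expnD leq_exp2l //; lia.
Qed.

(** The factor [zeta1] makes up for the [- 1] in the exponent of [zeta2]:
    as [z < z + 1 <= 2^z], the product is at most [(2^z)^(2^z)]. *)
Lemma upsilon_bound m d p X : m < d -> d <= X -> p <= X ->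
  zeta1 m p d * zeta2 m p d <= iter 5 F X.
Proof.
move=> m_lt_d d_le_X p_le_X.
have := zeta1_bound m d p X m_lt_d d_le_X p_le_X; rewrite /zeta2; set z := zeta1 m p d => z_le.
have zF := mul_exp_le_expgrow z.
apply: leq_trans (exp_le_expgrow_leq _ _ (expgrow_mono _ _ z_le)).
apply: leq_trans (_ : 2 ^ (z * 2 ^ z) <= _); last by rewrite leq_exp2l //; lia.
have z_lt : z < 2 ^ z by exact: ltn_expl.
have e_gt0 : 0 < 2 ^ z by rewrite expn_gt0.
have -> : 2 ^ (z * 2 ^ z) = 2 ^ z * (2 ^ z) ^ (2 ^ z - 1).
  by rewrite -expnS subn1 prednK // expnM.
apply: leq_mul; first exact: ltnW.
by case: (_ - 1) => // k; rewrite leq_exp2r // addn1.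
Qed.

Lemma bin_term_bound m X u :
  m < X -> u <= iter 5 F X -> 2 * 'C(u + m.+1, m.+1) * u <= iter 7 F X.
Proof.
set U := iter 5 F X => m_lt_X u_le.
have U_ge : X <= U := leq_iter_expgrow 5 X.
apply: leq_trans (exp_le_expgrow_leq _ _ (linear_le_expgrow U)).
apply: (@leq_trans (2 * 2 ^ (2 * U) * 2 ^ U)).
  apply: leq_mul; last exact: leq_trans u_le (ltnW (ltn_expl _ _)).
  rewrite leq_mul2l /=; apply: leq_trans (bin_le_exp2 _ _) _.
  by rewrite leq_exp2l //; lia.
by rewrite -expnS -expnD leq_exp2l //; lia.
Qed.

Lemma ee_bound m d X : m < d -> d <= X -> ee m d <= iter 6 F X.
Proof.
move=> m_lt_d d_le_X.
have m1_lt : m.-1 < X by lia.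
have := dd_bound _ _ _ m1_lt d_le_X; rewrite /ee; set D := dd _ _.
rewrite -[F (F X)]/(iter 2 F X); set W := iter 2 F X => DW.
set V := iter 4 F X.
have WF := mul_exp_le_expgrow W.
have W_lt : W < 2 ^ W by exact: ltn_expl.
have WW : W * W <= F W by nia.
have A_le : (d + D) ^ m.-1 <= V.
  apply: (@leq_trans (2 ^ (W * W))); last first.
    exact: exp_le_expgrow_leq WW.
  rewrite expnM; apply: (@leq_trans ((2 ^ W) ^ m.-1)).
    by case: m.-1 => // k; rewrite leq_exp2r //; lia.
  by rewrite leq_exp2l; lia.
have V_ge : W <= V := leq_iter_expgrow 2 W.
apply: leq_trans (exp_le_expgrow_leq _ _ (linear_le_expgrow V)).
have V_lt : V < 2 ^ V by exact: ltn_expl.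
have pow_le : 2 ^ ((d + D) ^ m.-1 + 1) <= 2 * 2 ^ V.
  by rewrite -expnS leq_exp2l // addn1.
have -> : 2 ^ (3 * V + 1) = 2 * 2 ^ V * (2 ^ V * 2 ^ V).
  by rewrite -!expnS -!expnD; congr (2 ^ _); lia.
(* The left-hand side is [B d + (d + D)] with [B <= 2 * 2^V] and
   [d, d + D <= V < 2^V], whence less than [3 * 4^V]. *)
have dV : d <= V by lia.
have := leq_mul pow_le dV.
by nia.
Qed.

Lemma pp_le_iter_expgrow n d : n < d -> pp n.+1 d <= iter (8 * n.+1) expgrow d.
Proof.
elim: n => [|n IH] n_lt_d; first exact: leq_iter_expgrow.
have {}IH := IH (ltnW n_lt_d).
rewrite pp_rec // /upsilon [_.-1]/= mulnS iterD.
have d_le := leq_iter_expgrow (8 * n.+1) d.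
set X := iter (8 * n.+1) _ _ in IH d_le *.
have u_le := upsilon_bound n.+1 d _ X n_lt_d d_le IH.
have left_le := bin_term_bound n.+1 X _ (leq_trans n_lt_d d_le) u_le.
have ee_le := ee_bound n.+1 d X n_lt_d d_le.
rewrite geq_max; apply/andP; split.
  exact: leq_trans left_le (leq_expgrow _).
exact: leq_trans ee_le (leq_iter_expgrow 2 _).
Qed.

Theorem lemma7p7 (n d : nat) (hn : 1 <= n) (hd : n <= d) :
  pp n d <= oiter GG (omul_pow (ofin 2) (8 * n)) d.
Proof.
rewrite oiter_mul_pow (eq_iter oiter_GG_omega2).
by case: n hn hd => // n _; exact: pp_le_iter_expgrow.
Qed.
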